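(* Let $H$ be a complex Hilbert space, let $L_0$ be a (densely defined) symmetric minimal operator in $H$, let $\widehat{L}=L_0^*$ be the corresponding maximal operator, let $L$ be a self-adjoint correct extension of $L_0$, and let $L_K$ be a correct restriction of $\widehat{L}$, with $$L_K^{-1}f=L^{-1}f+Kf,\qquad f\in H,$$ where $K$ is a bounded linear operator on $H$ with $R(K)\subset \operatorname{Ker}\widehat{L}$. If $$R(K^* )\subset D(L),\qquad I+KL\ge 0,$$ and $I+KL$ is invertible, then $L_K$ is similar to a self-adjoint operator.
   Context: $D(\cdot)$, $R(\cdot)$, $\operatorname{Ker}$ denote domain, range and kernel; $I$ is the identity on $H$. A linear operator $A$ in $H$ is correctly solvable if there is $C>0$ with $\|u\|\le C\|Au\|$ for all $u\in D(A)$, and everywhere solvable if $R(A)=H$; $A$ is a correct operator if both hold (so $A^{-1}$ is a bounded operator defined on all of $H$). A correctly solvable operator $L_0$ is minimal if $\overline{R(L_0)}\ne H$. A closed operator $\widehat{L}$ is maximal if $R(\widehat{L})=H$ and $\operatorname{Ker}\widehat{L}\neq\{0\}$. $A$ is a restriction of $B$ (and $B$ an extension of $A$) if $D(A)\subset D(B)$ and $Au=Bu$ for $u\in D(A)$. A correct extension of $L_0$ (correct restriction of $\widehat L$) is an extension of $L_0$ (restriction of $\widehat L$) that is a correct operator. Every correct restriction $L_K$ of $\widehat{L}$ has inverse $L_K^{-1}=L^{-1}+K$ for a bounded linear operator $K$ from $H$ into $\operatorname{Ker}\widehat{L}$, and then $D(L_K)=\{u\in D(\widehat{L}): (I-K\widehat{L})u\in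 D(L)\}$. When $R(K^* )\subset D(L)$ (with $L=L^*$), the operator $KL$, defined on the dense set $D(L)$, is bounded there; $KL$ denotes its bounded extension (closure) to all of $H$. For a bounded operator $T$ on $H$, $T\ge 0$ means $(Tx,x)\ge 0$ for all $x\in H$, and invertible means having a bounded inverse defined on all of $H$. A (possibly unbounded) operator $A$ is similar to $B$ if $A=SBS^{-1}$ (with equality of domains, $D(A)=S\,D(B)$) for some bounded, boundedly invertible operator $S$ on $H$. *)

(* Defs.v *)
From HB Require Import structures.
From mathcomp Require Import all_boot all_order all_algebra.
From mathcomp Require Import sesquilinear complex.
From mathcomp Require Import boolp classical_sets functions reals topology.
From mathcomp Require Import normedtype.

Set Implicit Arguments.
Unset Strict Implicit.
Unset Printing Implicit Defensive.

Import Order.TTheory GRing.Theory Num.Theory.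
Import numFieldNormedType.Exports.

Local Open Scope classical_set_scope.
Local Open Scope complex_scope.
Local Open Scope ring_scope.

(* A complex Hilbert space is a complete normed module H over R[i] together
   with a form dot : {dot H for conj}, i.e. a positive definite Hermitian form,
   linear in its first and conjugate-linear in its second argument, that
   induces the norm of H. *)
Definition is_inner_product (R : realType) (H : completeNormedModType R[i])
    (dot : {dot H for @Num.conj R[i]}) : Prop :=
  forall x : H, `|x| ^+ 2 = dot x x.

(* A possibly unbounded operator in H. The values of opfun outside opdom are
   irrelevant: operators are compared with op_eq, not with Leibniz equality. *)
Record operator (R : realType) (H : completeNormedModType R[i]) := Operator {
  opdom : set H;
  opfun :> H -> H
}.

Section Operators.
Variables (R : realType) (H : completeNormedModType R[i]).
Implicit Types A B S T : operator H.

Definition linear_op A : Prop :=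
  [/\ opdom A 0,
      forall (a : R[i]) (u v : H), opdom A u -> opdom A v ->
        opdom A (a *: u + v)
    & forall (a : R[i]) (u v : H), opdom A u -> opdom A v ->
        A (a *: u + v) = a *: A u + A v].

Definition oprange A : set H := A @` opdom A.

Definition opker A : set H := [set u | opdom A u /\ A u = 0].

Definition opgraph A : set (H * H)%type :=
  [set z | opdom A z.1 /\ z.2 = A z.1].

Definition restriction_of A B : Prop :=
  opdom A `<=` opdom B /\ forall u, opdom A u -> A u = B u.

Definition op_eq A B : Prop :=
  opdom A = opdom B /\ forall u, opdom A u -> A u = B u.

Definition id_op : operator H := Operator setT (fun u => u).

Definition add_op A B : operator H :=
  Operator (opdom A `&` opdom B) (fun u => A u + B u).

Definition comp_op A B : operator H :=
  Operator [set u | opdom B u /\ opdom A (B u)] (fun u => A (B u)).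

(* Meaningful when A is injective on its domain. *)
Definition inv_op A : operator H :=
  Operator (oprange A) (fun f => xget 0 [set u | opdom A u /\ A u = f]).

(* The operator whose graph is the closure of the graph of A; meaningful when A
   is closable. *)
Definition closure_op A : operator H :=
  Operator [set u | exists v, closure (opgraph A) (u, v)]
           (fun u => xget 0 [set v | closure (opgraph A) (u, v)]).

Definition closed_op A : Prop := closed (opgraph A).

Definition bounded_op A : Prop :=
  [/\ linear_op A, opdom A = setT
    & exists M : R, forall u : H, `|A u| <= M%:C * `|u|].

Definition invertible_op A : Prop :=
  set_inj (opdom A) A /\ bounded_op (inv_op A).

Definition correctly_solvable A : Prop :=
  exists2 C : R, 0 < C & forall u, opdom A u -> `|u| <= C%:C * `|A u|.

Definition everywhere_solvable A : Prop := oprange A = setT.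

Definition correct_op A : Prop :=
  correctly_solvable A /\ everywhere_solvable A.

Definition minimal_op A : Prop :=
  correctly_solvable A /\ closure (oprange A) <> setT.

Definition maximal_op A : Prop :=
  [/\ closed_op A, oprange A = setT & opker A <> [set 0]].

Definition similar_op A B : Prop :=
  exists S : operator H,
    [/\ bounded_op S, invertible_op S
      & op_eq A (comp_op S (comp_op B (inv_op S)))].

Section Adjoint.
Variable dot : {dot H for @Num.conj R[i]}.

(* Meaningful when A is densely defined: w is then unique. *)
Definition adjoint A : operator H :=
  let adj v w := forall u, opdom A u -> dot (A u) v = dot u w in
  Operator [set v | exists w, adj v w] (fun v => xget 0 [set w | adj v w]).

Definition symmetric_op A : Prop :=
  [/\ linear_op A, dense (opdom A)
    & forall u v, opdom A u -> opdom A v -> dot (A u) v = dot u (A v)].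

Definition self_adjoint A : Prop :=
  [/\ linear_op A, dense (opdom A) & op_eq A (adjoint A)].

(* In R[i], 0 <= z says that z is real and nonnegative. *)
Definition nonneg_op A : Prop :=
  forall x, opdom A x -> 0 <= dot (A x) x.

End Adjoint.
End Operators.

Arguments id_op {R} H.

(* Main.v *)
Require Import Defs.
From HB Require Import structures.
From mathcomp Require Import all_boot all_order all_algebra.
From mathcomp Require Import sesquilinear complex.
From mathcomp Require Import boolp classical_sets functions reals topology.
From mathcomp Require Import normedtype sequences.
From mathcomp Require Import ring lra.

Import Order.TTheory GRing.Theory Num.Theory.
Import numFieldNormedType.Exports.

Local Open Scope classical_set_scope.
Local Open Scope complex_scope.
Local Open Scope ring_scope.

(** Write [P] for [I + KL], with [KL] replaced by its closure. For [f = L u]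
the hypothesis on the inverses reads [L_K^-1 f = u + K L u = P u], so that
[L_K = L P^-1]. If [P = S^2] with [S] symmetric, bounded and boundedly
invertible, then [L_K = L S^-2 = S (S^-1 L S^-1) S^-1], and [S^-1 L S^-1] is
self-adjoint because [L] is ([similar_self_adjoint]). Two points need work.

The operator [P] is everywhere defined and bounded. The Riesz representation
[riesz] makes [K^*] everywhere defined; since its range lies in the domain of
[L], so is [L K^*], and [(K L u, v) = (u, L K^* v)]. A map with an everywhere
defined formal adjoint is bounded ([hellinger_toeplitz]), and a bounded densely
defined operator has a bounded everywhere defined closure ([bounded_closure]).

The operator [P] has such a square root. It is nonnegative, hence symmetric
([nonneg_sym]), and bounded below because it is invertible. Therefore
[B = I - P / m^2] is a strict contraction for [m] large
([scaled_contraction]), and the equation [2 Y = B + Y^2], which says that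
[(I - Y)^2 = P / m^2], is solved by a norm convergent iteration
([sqrt_fixpoint]). Thus [S = m (I - Y)], and its inverse [S P^-1] is bounded.

Norms and forms take their values in [R[i]], whose order is only partial. The
estimates are therefore carried out on the real numbers [rnorm x] and
[redot x y], the real parts of the norm and of the inner product. *)

(** * Geometric sequences *)

Lemma le0_of_geometric (R : realType) (a c r : R) : 0 <= r -> r < 1 ->
  (forall n, a <= c * r ^+ n) -> a <= 0.
Proof.
move=> r0 r1 ha.
have hcv : (fun n => c * r ^+ n) @ \oo --> c * (0 : R).
  by apply: cvgMl_tmp; apply: cvg_expr; rewrite ger0_norm.
rewrite mulr0 in hcv.
rewrite -(cvg_lim _ hcv) //.
apply: limr_ge; first by apply/cvg_ex; exists 0.
by apply: nearW => n; exact: ha.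
Qed.

Lemma small_geometric (R : realType) (c r e : R) : 0 <= r -> r < 1 -> 0 < e ->
  exists n, c * r ^+ n < e.
Proof.
move=> r0 r1 e0; apply: contrapT => /forallNP hF.
suff : e <= 0 by rewrite leNgt e0.
by apply: (@le0_of_geometric _ _ c r) => // n; rewrite leNgt; apply/negP/hF.
Qed.

(** * The real norm and completeness *)

Lemma ReD (R : realType) (a b : R[i]) :
  complex.Re (a + b) = complex.Re a + complex.Re b.
Proof. by case: a b => ? ? [? ?]. Qed.

Lemma ReZ (R : realType) (r : R) (a : R[i]) :
  complex.Re (r%:C * a) = r * complex.Re a.
Proof. by case: a => ? ? /=; rewrite mul0r subr0. Qed.

Lemma ReMi (R : realType) (a : R[i]) :
  complex.Re ('i%C * a) = - complex.Im a.
Proof. by case: a => ? ? /=; rewrite mul0r mul1r sub0r. Qed.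


Section RealNorm.
Context {R : realType} {H : completeNormedModType R[i]}.
Implicit Types (x y z u v : H) (r c : R).

Definition rnorm x : R := complex.Re `|x|.

Lemma norm_rnorm x : `|x| = (rnorm x)%:C.
Proof. by rewrite /rnorm RRe_real // ger0_real. Qed.

Lemma rnorm_ge0 x : 0 <= rnorm x.
Proof. by rewrite -ler0c -norm_rnorm. Qed.

Lemma rnorm0 : rnorm 0 = 0.
Proof. by rewrite /rnorm normr0. Qed.

Lemma rnorm_le0 x : rnorm x <= 0 -> x = 0.
Proof.
move=> x0; apply/normr0_eq0; rewrite norm_rnorm.
by have -> : rnorm x = 0 by apply/eqP; rewrite eq_le x0 rnorm_ge0.
Qed.

Lemma rnormD x y : rnorm (x + y) <= rnorm x + rnorm y.
Proof. by rewrite -lecR rmorphD /= -!norm_rnorm ler_normD. Qed.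

Lemma rnormN x : rnorm (- x) = rnorm x.
Proof. by rewrite /rnorm normrN. Qed.

Lemma rnorm_distC x y : rnorm (x - y) = rnorm (y - x).
Proof. by rewrite /rnorm distrC. Qed.

Lemma rnorm_distT z x y : rnorm (x - y) <= rnorm (x - z) + rnorm (z - y).
Proof. by rewrite -{1}(subrK z x) -addrA rnormD. Qed.

Lemma rnormZ (a : R[i]) x : rnorm (a *: x) = complex.Re `|a| * rnorm x.
Proof.
rewrite {1}/rnorm normrZ -[`|a|]RRe_real ?ger0_real// norm_rnorm.
by rewrite -rmorphM.
Qed.

Lemma rnormZr r x : rnorm (r%:C *: x) = `|r| * rnorm x.
Proof.
rewrite rnormZ normc_def /= expr0n /= addr0 sqrtr_sqr.
by [].
Qed.

(** All limits below have geometric rate; the explicit error bound lets identities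
and estimates pass to the limit through [le0_of_geometric]. *)
Lemma geometric_cvg (u : nat -> H) c r : 0 <= c -> 0 <= r -> r < 1 ->
  (forall n, rnorm (u n.+1 - u n) <= c * r ^+ n) ->
  exists x, forall n, rnorm (x - u n) <= c / (1 - r) * r ^+ n.
Proof.
move=> c0 r0 r1 hu.
have r1' : 0 < 1 - r by lra.
have step n k : rnorm (u (n + k)%N - u n) <= c / (1 - r) * r ^+ n * (1 - r ^+ k).
  elim: k => [|k IH]; first by rewrite addn0 subrr rnorm0 expr0 subrr mulr0.
  rewrite addnS (le_trans (rnorm_distT (u (n + k)%N) _ _))//.
  apply: le_trans (lerD (hu _) IH) _.
  rewrite exprD exprS le_eqVlt; apply/orP; left; apply/eqP.
  by field; lra.
have tail n k : rnorm (u (n + k)%N - u n) <= c / (1 - r) * r ^+ n.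
  apply: le_trans (step n k) _; rewrite -[leRHS]mulr1 ler_wpM2l //.
    by rewrite mulr_ge0 ?exprn_ge0// divr_ge0// ltW.
  by rewrite gerBl exprn_ge0.
have cv : cvgn u.
  apply: cauchy_cvg; apply: cauchy_exP => e e0.
  have er : 0 < complex.Re e by move: e0; rewrite ltcE /= => /andP[].
  have eE : e = (complex.Re e)%:C by rewrite RRe_real// ger0_real// ltW.
  have [n nlt] := @small_geometric _ (c / (1 - r)) r _ r0 r1 er.
  exists (u n); exists n => // m /= nm.
  rewrite -ball_normE /= norm_rnorm rnorm_distC eE ltcR.
  by rewrite -(subnKC nm) (le_lt_trans (tail _ _)).
exists (limn u) => n.
apply/ler_addgt0Pr => e e0.
have /cvgrPdist_lt /(_ e%:C) := cv; rewrite ltcR => /(_ e0) [m _ hm].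
have := hm (n + m)%N; rewrite /= leq_addl => /(_ isT).
rewrite norm_rnorm ltcR => h.
by rewrite [leRHS]addrC (le_trans (rnorm_distT (u (n + m)%N) _ _))// lerD// ltW.
Qed.

End RealNorm.

(** * The real part of the inner product *)

Section RealInnerProduct.
Context {R : realType} {H : completeNormedModType R[i]}.
Context (dot : {dot H for @Num.conj R[i]}) (hdot : is_inner_product dot).
Implicit Types (x y z u v : H) (r c : R).

Definition redot x y : R := complex.Re (dot x y).

Lemma dotC x y : dot y x = (dot x y)^*%C.
Proof. by rewrite (hermC dot) expr0 mul1r. Qed.

Lemma redotC x y : redot y x = redot x y.
Proof. by rewrite /redot dotC; case: (dot x y). Qed.

Lemma redotDl x y z : redot (x + y) z = redot x z + redot y z.
Proof. by rewrite /redot linearDl; exact: ReD. Qed.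

Lemma redotDr x y z : redot z (x + y) = redot z x + redot z y.
Proof. by rewrite redotC redotDl !(redotC z). Qed.

Lemma redotZl r x y : redot (r%:C *: x) y = r * redot x y.
Proof. by rewrite /redot linearZl_LR; exact: ReZ. Qed.

Lemma redotZr r x y : redot x (r%:C *: y) = r * redot x y.
Proof. by rewrite redotC redotZl redotC. Qed.

Lemma redot0r x : redot x 0 = 0.
Proof. by apply: (addrI (redot x 0)); rewrite -redotDr !addr0. Qed.

Lemma redotNl x y : redot (- x) y = - redot x y.
Proof. by apply/eqP; rewrite -addr_eq0 -redotDl addNr redotC redot0r. Qed.

Lemma redotNr x y : redot x (- y) = - redot x y.
Proof. by rewrite redotC redotNl redotC. Qed.

Lemma redotxx x : redot x x = rnorm x ^+ 2.
Proof. by rewrite /redot -hdot norm_rnorm -rmorphXn. Qed.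

(** Multiplication by the imaginary unit turns imaginary parts of [dot] into
real ones, so that complex identities can be checked on [redot]. *)
Lemma redot_i x y : redot ('i%C *: x) y = - complex.Im (dot x y).
Proof. by rewrite /redot linearZl_LR; exact: ReMi. Qed.

Lemma dot_of_redot x y z w : redot x y = redot z w ->
  redot ('i%C *: x) y = redot ('i%C *: z) w -> dot x y = dot z w.
Proof.
rewrite !redot_i /redot => h /oppr_inj.
by move: h; case: (dot x y) (dot z w) => a b [c d] /= -> ->.
Qed.

Lemma redot_ir x y : redot x ('i%C *: y) = - redot ('i%C *: x) y.
Proof.
by rewrite -redotC !redot_i dotC; case: (dot x y) => ? ? /=; rewrite !opprK.
Qed.

Lemma redot_ii x y : redot ('i%C *: x) ('i%C *: y) = redot x y.
Proof.
rewrite redot_ir scalerA -expr2 sqr_i.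
by rewrite scaleN1r redotNl opprK.
Qed.

(** Polarization over the complex numbers: [(P z, z)] is real for [z = x],
[z = y] and [z = i y + x], and the imaginary part of the last value is,
up to sign, the difference of the real parts of [(P x, y)] and [(P y, x)]. *)
Lemma nonneg_sym (P : H -> H) : linear P -> (forall x, 0 <= dot (P x) x) ->
  forall x y, redot (P x) y = redot x (P y).
Proof.
move=> P_lin P0 x y.
have h z : redot ('i%C *: P z) z = 0 by rewrite redot_i ger0_Im ?oppr0.
have PD u v : P ('i%C *: u + v) = 'i%C *: P u + P v by exact: P_lin.
have := h ('i%C *: y + x).
rewrite PD scalerDr !redotDl !redotDr !redot_ii !h add0r addr0.
by rewrite scalerA -expr2 sqr_i scaleN1r redotNl [redot x _]redotC; lra.
Qed.

Lemma rnormD_sqr x y :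
  rnorm (x + y) ^+ 2 = rnorm x ^+ 2 + 2 * redot x y + rnorm y ^+ 2.
Proof. by rewrite -!redotxx redotDl !redotDr (redotC x y); ring. Qed.

(** Cauchy-Schwarz, from the square of the norm of [|y|^2 x - (x, y) y]. *)
Lemma redot_le x y : redot x y <= rnorm x * rnorm y.
Proof.
have hx := rnorm_ge0 x; have hy := rnorm_ge0 y.
have [y0|y0] := eqVneq (rnorm y) 0.
  by rewrite (@rnorm_le0 _ _ y) ?y0// redot0r rnorm0 mulr0.
have {y0}hy : 0 < rnorm y by rewrite lt_def y0.
have := sqr_ge0 (rnorm ((rnorm y ^+ 2)%:C *: x + (- redot x y)%:C *: y)).
rewrite rnormD_sqr !rnormZr redotZl redotZr normrN ger0_norm ?sqr_ge0//.
rewrite !exprMn real_normK ?num_real//.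
set a := rnorm x in hx *; set b := rnorm y in hy *; set c := redot x y.
have -> : (b ^+ 2) ^+ 2 * a ^+ 2 + 2 * (b ^+ 2 * (- c * c)) + c ^+ 2 * b ^+ 2 =
  b ^+ 2 * ((a * b) ^+ 2 - c ^+ 2) by ring.
rewrite pmulr_rge0 ?exprn_gt0// subr_ge0 => h.
have [c0|c0] := lerP c 0; first by rewrite (le_trans c0)// mulr_ge0 // ltW.
by rewrite -(ler_pXn2r (isT : (0 < 2)%N)) // ?nnegrE ?mulr_ge0// ltW.
Qed.

Lemma norm_redot_le x y : `|redot x y| <= rnorm x * rnorm y.
Proof.
by rewrite ler_norml redot_le andbT lerNl -redotNl -(rnormN x) redot_le.
Qed.

(** * Riesz representation and the Hellinger-Toeplitz principle *)

(** Riesz representation: the representing vector is the limit of a minimising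
sequence of the functional [|u|^2 - 2 f u], which is a Cauchy sequence by the
parallelogram law. *)
Lemma riesz (f : H -> R) c :
  (forall x y, f (x + y) = f x + f y) ->
  (forall r x, f (r%:C *: x) = r * f x) ->
  (forall x, f x <= c * rnorm x) ->
  exists w, forall u, f u = redot u w.
Proof.
move=> fD fZ fc.
pose J u := rnorm u ^+ 2 - 2 * f u.
have Jlb u : - c ^+ 2 <= J u.
  have := fc u; rewrite /J; have := sqr_ge0 (rnorm u - c); nra.
pose E := range J.
have Einf : has_inf E.
  split; first by exists (J 0), 0.
  by exists (- c ^+ 2) => _ [u _ <-]; exact: Jlb.
have iJ u : inf E <= J u by apply: ge_inf; [case: Einf|exact: imageT].
have h4 n : 0 < (2^-1 ^+ n) ^+ 2 :> R by rewrite !exprn_gt0 ?invr_gt0 ?ltr0n.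
have /choice[u hu] (n : nat) : exists v, J v < inf E + (2^-1 ^+ n) ^+ 2.
  by have [_ [v _ <-] hv] := inf_adherent (h4 n) Einf; exists v.
(* The parallelogram law, with [J] bounded below at the midpoint. *)
have Jmid a b : rnorm (a - b) ^+ 2 <= 2 * (J a - inf E) + 2 * (J b - inf E).
  have := iJ (2^-1%:C *: (a + b)).
  rewrite /J fZ fD rnormZr exprMn real_normK ?num_real// !rnormD_sqr rnormN redotNr; lra.
have ucauchy n : rnorm (u n.+1 - u n) <= 2 * 2^-1 ^+ n.
  rewrite -(ler_pXn2r (isT : (0 < 2)%N)) ?nnegrE ?rnorm_ge0 ?mulr_ge0 ?exprn_ge0 ?invr_ge0 ?ler0n//.
  apply: le_trans (Jmid _ _) _.
  have h1 := hu n; have := hu n.+1; rewrite [_ ^+ n.+1]exprS => h2.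
  move: h1 h2; set e := 2^-1 ^+ n => h1 h2.
  by have := sqr_ge0 e; nra.
have [|||w hw] := @geometric_cvg _ _ u 2 2^-1 _ _ _ ucauchy; [lra|lra|lra|].
exists w => v.
(* [d n] is half the derivative of [J] at [u n] along [v]; a step of length
   [2^-n] gains at most [4^-n], which forces it to be of order [2^-n]. *)
pose d n := redot v (u n) - f v.
have hd n s : s ^+ 2 = 1 -> s * d n <= (1 + rnorm v ^+ 2) / 2 * 2^-1 ^+ n.
  move=> s1; have e0 : 0 < 2^-1 ^+ n :> R by rewrite exprn_gt0 ?invr_gt0 ?ltr0n.
  have h1 := iJ (u n + (- s * 2^-1 ^+ n)%:C *: v); have h2 := hu n.
  move: h1 h2; rewrite /J fD fZ rnormD_sqr rnormZr exprMn real_normK ?num_real//.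
  rewrite redotZr (redotC v).
  rewrite exprMn sqrrN s1 /d; move: e0; set e := 2^-1 ^+ n => e0 h1 h2.
  rewrite -(ler_pM2l e0); nra.
have habs n : `|redot v w - f v| <=
    (4 * rnorm v + (1 + rnorm v ^+ 2) / 2) * 2^-1 ^+ n.
  have -> : redot v w - f v = redot v (w - u n) + d n by rewrite redotDr redotNr /d; ring.
  rewrite mulrDl; apply: le_trans (ler_normD _ _) _; apply: lerD.
    apply: le_trans (norm_redot_le _ _) _; rewrite mulrC -mulrA [rnorm v * _]mulrC mulrA.
    rewrite ler_wpM2r ?rnorm_ge0//; apply: le_trans (hw n) _.
    by rewrite le_eqVlt; apply/orP; left; apply/eqP; field.
  have := hd n 1; have := hd n (-1).
  rewrite sqrrN expr1n => /(_ erefl) ? /(_ erefl) ?.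
  by rewrite ler_norml; apply/andP; split; lra.
have : `|redot v w - f v| <= 0 by apply: le0_of_geometric habs; lra.
by rewrite normr_le0 subr_eq0 => /eqP.
Qed.

(** Gliding hump: if [B] were unbounded, steps along directions [B (u n)] would
lead to a point [y] at which the functionals [redot (B (u n))] are larger than
the adjoint relation allows, the vector [C y] being fixed. *)
Lemma hellinger_toeplitz (D : set H) (B C : H -> H) :
  (forall u v, D u -> redot (B u) v = redot u (C v)) ->
  exists2 M, 0 <= M & forall u, D u -> rnorm (B u) <= M * rnorm u.
Proof.
move=> adj; apply: contrapT => /forall2NP unb.
have /choice[u hu] (n : nat) :
    exists v, D v /\ 4 ^+ n * rnorm v < rnorm (B v).
  have [|/existsNP[v /not_implyP[Dv /negP]]] := unb (4 ^+ n).
    by move=> []; rewrite exprn_ge0.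
  by rewrite -ltNge; exists v.
have Bgt n : 0 < rnorm (B (u n)).
  by apply: le_lt_trans (hu n).2; rewrite mulr_ge0 ?exprn_ge0 ?rnorm_ge0.
pose e n := (rnorm (B (u n)))^-1%:C *: B (u n).
have e1 n : rnorm (e n) = 1.
  by rewrite rnormZr ger0_norm ?invr_ge0 ?rnorm_ge0// mulVf// gt_eqF.
(* The step in direction [e n] has length [3^-n] and the sign which does not
   decrease [|redot (e n) (x n)|]; all later steps together have length at most
   [3^-n / 2], so half of the hump survives. *)
pose sgn (t : R) : R := if 0 <= t then 1 else -1.
have sgn1 t : `|sgn t| = 1 by rewrite /sgn; case: ifP; rewrite ?normrN normr1.
pose x := fix x n := if n is k.+1
  then x k + (sgn (redot (e k) (x k)) * 3^-1 ^+ k)%:C *: e k else 0 : H.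
have xS n : rnorm (x n.+1 - x n) <= 1 * 3^-1 ^+ n.
  rewrite /= addrAC subrr add0r rnormZr e1 normrM sgn1 mulr1.
  by rewrite !mul1r ger0_norm ?exprn_ge0 ?invr_ge0 ?ler0n.
have hump n : 3^-1 ^+ n <= `|redot (e n) (x n.+1)|.
  rewrite /= redotDr redotZr redotxx e1 expr1n mulr1 /sgn.
  have : 0 <= 3^-1 ^+ n :> R by rewrite exprn_ge0 ?invr_ge0 ?ler0n.
  set t := redot _ _; set d := 3^-1 ^+ n => d0.
  by rewrite ler_normr; apply/orP; case: (lerP 0 t) => ?; [left|right]; lra.
have [|||y hy] := @geometric_cvg _ _ x 1 3^-1 _ _ _ xS; [lra|lra|lra|].
have yhump n : 3^-1 ^+ n / 2 <= `|redot (e n) y|.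
  have h1 := hy n.+1; have h2 := hump n.
  have h3 := norm_redot_le (e n) (x n.+1 - y).
  rewrite e1 mul1r rnorm_distC redotDr redotNr in h3.
  have h4 := ler_normD (redot (e n) (x n.+1) - redot (e n) y) (redot (e n) y).
  rewrite subrK in h4.
  move: h1; rewrite exprS => h1.
  have h1' : rnorm (y - x n.+1) <= 3^-1 ^+ n / 2.
    by apply: le_trans h1 _; rewrite le_eqVlt; apply/orP; left; apply/eqP; field.
  lra.
(* The ratio [3 / 4] compares the humps [3^-n] with the growth [4^n] of [B]. *)
have : 2^-1 <= 0 :> R.
  apply: (@le0_of_geometric _ _ (rnorm (C y)) (3 / 4)); [lra|lra|move=> n].
  have h1 := yhump n; have h2 := (hu n).2; have b0 := Bgt n.
  have h3 : `|redot (e n) y| <= (rnorm (B (u n)))^-1 * (rnorm (u n) * rnorm (C y)).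
    rewrite redotZl (adj _ _ (proj1 (hu n))) normrM ger0_norm ?invr_ge0 ?rnorm_ge0//.
    by rewrite ler_wpM2l ?invr_ge0 ?rnorm_ge0// norm_redot_le.
  have h4 : (rnorm (B (u n)))^-1 * rnorm (u n) <= 4^-1 ^+ n.
    by rewrite mulrC ler_pdivrMr// exprVn mulrC ler_pdivlMr ?exprn_gt0// mulrC ltW.
  have h5 : `|redot (e n) y| <= 4^-1 ^+ n * rnorm (C y).
    by apply: le_trans h3 _; rewrite mulrA ler_wpM2r ?rnorm_ge0.
  have h6 := le_trans h1 h5.
  have p3 : 0 < 3 ^+ n :> R by rewrite exprn_gt0 ?invr_gt0 ?ltr0n.
  move: h6; rewrite -(ler_pM2l p3) mulrA -exprMn mulfV ?pnatr_eq0// expr1n mul1r.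
  by rewrite mulrA -exprMn mulrC.
lra.
Qed.

End RealInnerProduct.

(** * Everywhere defined linear maps *)

Section LinearMaps.
Context {R : realType} {H : completeNormedModType R[i]}.
Context (f : H -> H) (f_lin : linear f).

Lemma lin0 : f 0 = 0.
Proof. by have := f_lin (-1) 0 0; rewrite !scaleN1r !addNr. Qed.

Lemma linD x y : f (x + y) = f x + f y.
Proof. by have := f_lin 1 x y; rewrite !scale1r. Qed.

Lemma linZ a x : f (a *: x) = a *: f x.
Proof. by have := f_lin a x 0; rewrite !addr0 lin0 addr0. Qed.

Lemma linN x : f (- x) = - f x.
Proof. by rewrite -scaleN1r linZ scaleN1r. Qed.

Lemma linB x y : f (x - y) = f x - f y.
Proof. by rewrite linD linN. Qed.

End LinearMaps.

(** * Density and closures of graphs *)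

Section Topology.
Context {R : realType} {H : completeNormedModType R[i]}.
Implicit Types (x y z u v : H) (r c e : R) (A : operator H).

Lemma ball_rnorm x y e : ball x e%:C y <-> rnorm (x - y) < e.
Proof. by rewrite -ball_normE /= norm_rnorm ltcR. Qed.

Lemma nbhs_rnormP x (B : set H) :
  nbhs x B <-> exists2 e, 0 < e & forall y, rnorm (x - y) < e -> B y.
Proof.
split=> [/nbhs_ballP[e /= e0 eB]|[e e0 eB]].
  have eE : e = (complex.Re e)%:C by rewrite RRe_real// ger0_real// ltW.
  exists (complex.Re e); first by rewrite -ltcR -eE.
  by move=> y yx; apply: eB; rewrite eE; apply/ball_rnorm.
apply/nbhs_ballP; exists e%:C => /=; first by rewrite ltcR.
by move=> y /ball_rnorm; exact: eB.
Qed.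

Lemma dense_rnormP (D : set H) :
  dense D <-> forall x e, 0 < e -> exists2 u, D u & rnorm (x - u) < e.
Proof.
split=> [dD x e e0|hD O [x Ox] oO].
  have ec : 0 < e%:C by rewrite ltcR.
  have x0 : ball x e%:C !=set0 by exists x; exact: ballxx.
  have [u [xu Du]] := dD _ x0 (ball_open x _).
  by exists u => //; apply/ball_rnorm.
have /nbhs_rnormP[e e0 eO] : nbhs x O by apply: open_nbhs_nbhs.
by have [u Du /eO Ou] := hD x e e0; exists u.
Qed.

Lemma closure_graphP A x v : closure (opgraph A) (x, v) <->
  forall e, 0 < e ->
  exists u, [/\ opdom A u, rnorm (x - u) < e & rnorm (v - A u) < e].
Proof.
split=> [cl e e0|h B [[/= B1 B2]]]; last first.
  move=> [/nbhs_rnormP[e1 e10 h1] /nbhs_rnormP[e2 e20 h2]] hB.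
  have e0 : 0 < Num.min e1 e2 by rewrite lt_min e10 e20.
  have [u [Du]] := h _ e0; rewrite !lt_min => /andP[xu _] /andP[_ vu].
  by exists (u, A u); split=> //; apply: hB; split; [exact: h1|exact: h2].
pose U := [set z : H * H | rnorm (x - z.1) < e /\ rnorm (v - z.2) < e].
have [|[u w] /= [[/= Du ->] [xu vw]]] := cl U; last by exists u.
exists ([set y | rnorm (x - y) < e], [set y | rnorm (v - y) < e]) => //=.
by split; apply/nbhs_rnormP; exists e.
Qed.

(** The closure of the graph is a linear relation obeying the bound of [A], hence
the graph of a map; it is everywhere defined because [A] maps a sequence that
converges geometrically to one that converges geometrically. *)
Lemma bounded_closure A M : linear_op A -> dense (opdom A) -> 0 <= M ->
  (forall u, opdom A u -> rnorm (A u) <= M * rnorm u) ->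
  exists T : H -> H, [/\ linear T, forall x, rnorm (T x) <= M * rnorm x &
    forall x v, closure (opgraph A) (x, v) <-> v = T x].
Proof.
move=> [A0 AD Alin] /dense_rnormP dA M0 AM.
pose cl x v := closure (opgraph A) (x, v).
have clD a x v y w : cl x v -> cl y w -> cl (a *: x + y) (a *: v + w).
  move=> /closure_graphP h1 /closure_graphP h2; apply/closure_graphP => e e0.
  pose b := complex.Re `|a|.
  have b0 : 0 <= b by rewrite /b normc_def /= sqrtr_ge0.
  have d0 : 0 < e / (b + 1) by rewrite divr_gt0//; lra.
  have eE : b * (e / (b + 1)) + e / (b + 1) = e by field; lra.
  have [u1 [D1 x1 v1]] := h1 _ d0; have [u2 [D2 x2 v2]] := h2 _ d0.
  have est (p q s t : H) : rnorm (p - s) < e / (b + 1) ->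
      rnorm (q - t) < e / (b + 1) -> rnorm (a *: p + q - (a *: s + t)) < e.
    move=> hp hq; rewrite opprD addrACA -scalerBr -eE.
    apply: le_lt_trans (rnormD _ _) _; rewrite rnormZ -/b.
    by apply: ler_ltD => //; rewrite ler_wpM2l// ltW.
  exists (a *: u1 + u2); split; [exact: AD|exact: est|].
  by rewrite Alin//; exact: est.
have clM x v : cl x v -> rnorm v <= M * rnorm x.
  move=> /closure_graphP h; apply/ler_addgt0Pr => e e0.
  have d0 : 0 < e / (M + 1) by rewrite divr_gt0//; lra.
  have eE : M * (e / (M + 1)) + e / (M + 1) = e by field; lra.
  have [u [Du xu vu]] := h _ d0.
  have h1 := rnorm_distT (A u) v 0; rewrite !subr0 in h1.
  have h2 := rnorm_distT x u 0; rewrite !subr0 (rnorm_distC u) in h2.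
  have h3 := AM u Du; rewrite -eE.
  have h4 : M * rnorm u <= M * (e / (M + 1) + rnorm x).
    by rewrite ler_wpM2l//; lra.
  by move: h4; rewrite mulrDr; lra.
have clE x : exists v, cl x v.
  have /choice[u hu] (n : nat) : exists u, opdom A u /\ rnorm (x - u) < 2^-1 ^+ n.
    have [|u Du xu] := dA x (2^-1 ^+ n); first by rewrite exprn_gt0 ?invr_gt0 ?ltr0n.
    by exists u.
  have AB v w : opdom A v -> opdom A w ->
      A (w - v) = A w - A v /\ opdom A (w - v).
    move=> Dv Dw; have -> : w - v = (-1) *: v + w by rewrite scaleN1r addrC.
    by split; [rewrite Alin// scaleN1r addrC|exact: AD].
  have cau n : rnorm (A (u n.+1) - A (u n)) <= 2 * M * 2^-1 ^+ n.
    have [D1 x1] := hu n; have [D2] := hu n.+1; rewrite exprS => x2.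
    have [<- /AM h1] := AB _ _ D1 D2; apply: le_trans h1 _.
    rewrite [2 * M]mulrC -mulrA ler_wpM2l//.
    have := rnorm_distT x (u n.+1) (u n); rewrite (rnorm_distC _ x).
    by have := rnorm_ge0 (x - u n); lra.
  have [|||v hv] := @geometric_cvg _ _ (fun n => A (u n)) (2 * M) 2^-1 _ _ _ cau;
    [by rewrite mulr_ge0|lra|lra|].
  exists v; apply/closure_graphP => e e0.
  have [||n n_lt] :=
    @small_geometric _ (2 * M / (1 - 2^-1) + 1) 2^-1 e _ _ e0; [lra|lra|].
  have p0 : 0 < 2^-1 ^+ n :> R by rewrite exprn_gt0 ?invr_gt0 ?ltr0n.
  have q0 : 0 <= 2 * M / (1 - 2^-1) * 2^-1 ^+ n.
    by rewrite !mulr_ge0// ?invr_ge0; lra.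
  have [Du xu] := hu n; have hvn := hv n; move: n_lt; rewrite mulrDl mul1r => n_lt.
  by exists (u n); split => //; lra.
have [T hT] := choice clE.
have Tuniq x v : cl x v -> v = T x.
  move=> clv; have := clM _ _ (clD (-1) _ _ _ _ clv (hT x)).
  rewrite !scaleN1r addNr rnorm0 mulr0 => /rnorm_le0 /eqP.
  by rewrite addrC subr_eq0 => /eqP.
exists T; split.
- by move=> a x y; apply/esym/Tuniq; exact: clD.
- by move=> x; exact: clM.
- by move=> x v; split=> [/Tuniq//|->]; exact: hT.
Qed.

End Topology.

(** * Square roots of positive invertible operators *)

Section SquareRoot.
Context {R : realType} {H : completeNormedModType R[i]}.
Context (dot : {dot H for @Num.conj R[i]}) (hdot : is_inner_product dot).
Implicit Types (x y z u v : H) (r c q m N : R).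
Local Notation rdot := (redot dot).

(** The square root of [1 - B] is [1 - Y], where [Y] solves [2 Y = B + Y^2].
Iterating this equation from [0] stays in the ball of radius [q], where
[Y |-> (B + Y^2) / 2] is Lipschitz with constant [q]; the limit is taken
pointwise, with an error that is uniform on bounded sets. *)
Lemma sqrt_fixpoint (B : H -> H) q : 0 <= q -> q < 1 -> linear B ->
  (forall x y, rdot (B x) y = rdot x (B y)) ->
  (forall x, rnorm (B x) <= q * rnorm x) ->
  exists Y : H -> H, [/\ linear Y, forall x y, rdot (Y x) y = rdot x (Y y),
    forall x, rnorm (Y x) <= q * rnorm x & forall x, Y x + Y x = B x + Y (Y x)].
Proof.
move=> q0 q1 B_lin B_sym Bq.
pose Yn := fix Yn n := if n is k.+1
  then fun x => 2^-1%:C *: (B x + Yn k (Yn k x)) else fun=> 0 : H.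
have Yn_lin n : linear (Yn n).
  elim: n => [|n IH] a x y /=; first by rewrite scaler0 addr0.
  rewrite B_lin !IH addrACA scalerDr -[a *: _ + a *: _]scalerDr.
  by rewrite !scalerA [a * _]mulrC.
have Yn_sym n x y : rdot (Yn n x) y = rdot x (Yn n y).
  elim: n x y => [|n IH] x y /=; first by rewrite redot0r redotC redot0r.
  by rewrite redotZl redotZr redotDl redotDr B_sym !IH.
have half x : rnorm (2^-1%:C *: x) = rnorm x / 2.
  by rewrite rnormZr ger0_norm ?invr_ge0 ?ler0n// mulrC.
have Ynq n x : rnorm (Yn n x) <= q * rnorm x.
  elim: n x => [|n IH] x /=; first by rewrite rnorm0 mulr_ge0 ?rnorm_ge0.
  rewrite half; have h1 := rnormD (B x) (Yn n (Yn n x)); have h2 := Bq x.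
  have h3 := IH (Yn n x); have h4 : q * rnorm (Yn n x) <= 1 * (q * rnorm x).
    by rewrite ler_pM ?rnorm_ge0// ltW.
  lra.
have step n x : rnorm (Yn n.+1 x - Yn n x) <= rnorm x * q ^+ n.
  elim: n x => [|n IH] x.
    rewrite subr0 expr0 mulr1 (le_trans (Ynq 1%N x))//.
    by rewrite -[leRHS]mul1r ler_wpM2r ?rnorm_ge0 ?ltW.
  (* [Y'^2 - Y^2 = Y' (Y' - Y) + (Y' - Y) Y] for consecutive iterates, so that
     the iterates need not be known to commute. *)
  have -> : Yn n.+2 x - Yn n.+1 x = 2^-1%:C *:
      (Yn n.+1 (Yn n.+1 x - Yn n x) + (Yn n.+1 (Yn n x) - Yn n (Yn n x))).
    rewrite (linB _ (Yn_lin n.+1)) addrA subrK.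
    rewrite -[LHS]/(2^-1%:C *: _ - 2^-1%:C *: _).
    by rewrite -scalerBr opprD addrACA subrr add0r.
  rewrite half; have h1 := rnormD (Yn n.+1 (Yn n.+1 x - Yn n x))
    (Yn n.+1 (Yn n x) - Yn n (Yn n x)).
  have h2 := Ynq n.+1 (Yn n.+1 x - Yn n x).
  have h3 : q * rnorm (Yn n.+1 x - Yn n x) <= q * (rnorm x * q ^+ n).
    by rewrite ler_wpM2l.
  have h4 := IH (Yn n x).
  have h5 : rnorm (Yn n x) * q ^+ n <= q * rnorm x * q ^+ n.
    by rewrite ler_wpM2r ?exprn_ge0.
  rewrite exprS; move: h3 h4 h5; set t := q ^+ n => h3 h4 h5.
  have -> : rnorm x * (q * t) = q * (rnorm x * t) by ring.
  by move: h5; rewrite -mulrA => h5; lra.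
have p0 : 0 < 1 - q by lra.
have /choice[Y hY] x :
    exists y, forall n, rnorm (y - Yn n x) <= rnorm x / (1 - q) * q ^+ n.
  exact: (geometric_cvg _ _ _ (rnorm_ge0 x) q0 q1 (step^~ x)).
have lim0 x c : (forall n, rnorm x <= c * q ^+ n) -> x = 0.
  by move=> h; apply: rnorm_le0; exact: le0_of_geometric h.
have Y_lin : linear Y.
  move=> a x y; apply/eqP; rewrite -subr_eq0; apply/eqP.
  pose b := complex.Re `|a|.
  apply: (lim0 _ (rnorm (a *: x + y) / (1 - q) +
    (b * (rnorm x / (1 - q)) + rnorm y / (1 - q)))) => n.
  have -> : Y (a *: x + y) - (a *: Y x + Y y) =
      (Y (a *: x + y) - Yn n (a *: x + y)) - (a *: (Y x - Yn n x) + (Y y - Yn n y)).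
    by rewrite Yn_lin scalerBr [in RHS]addrACA -opprD opprB subrKA.
  rewrite !mulrDl; apply: le_trans (rnormD _ _) _; rewrite rnormN.
  apply: lerD; first exact: hY.
  apply: le_trans (rnormD _ _) _; rewrite rnormZ -/b -[b * _ * _]mulrA.
  have b0 : 0 <= b by rewrite /b normc_def /= sqrtr_ge0.
  by apply: lerD; [rewrite ler_wpM2l//; exact: hY|exact: hY].
have Yq x : rnorm (Y x) <= q * rnorm x.
  rewrite -subr_le0; apply: (@le0_of_geometric _ _ (rnorm x / (1 - q)) q) => // n.
  have h1 := rnorm_distT (Yn n x) (Y x) 0; rewrite !subr0 in h1.
  have h2 := hY x n; have h3 := Ynq n x; lra.
have Y_sym x y : rdot (Y x) y = rdot x (Y y).
  apply/eqP; rewrite -subr_eq0 -normr_le0.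
  apply: (@le0_of_geometric _ _ (2 * (rnorm x * rnorm y / (1 - q))) q) => // n.
  have -> : rdot (Y x) y - rdot x (Y y) =
      rdot (Y x - Yn n x) y - rdot x (Y y - Yn n y).
    by rewrite redotDl redotDr redotNl redotNr Yn_sym; ring.
  apply: le_trans (ler_normB _ _) _.
  have h1 := norm_redot_le _ hdot (Y x - Yn n x) y.
  have h2 := norm_redot_le _ hdot x (Y y - Yn n y).
  have h3 : rnorm (Y x - Yn n x) * rnorm y <= rnorm x / (1 - q) * q ^+ n * rnorm y.
    by rewrite ler_wpM2r ?rnorm_ge0.
  have h4 : rnorm x * rnorm (Y y - Yn n y) <= rnorm x * (rnorm y / (1 - q) * q ^+ n).
    by rewrite ler_wpM2l ?rnorm_ge0.
  rewrite [leRHS](_ : _ = rnorm x / (1 - q) * q ^+ n * rnorm y +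
      rnorm x * (rnorm y / (1 - q) * q ^+ n));
    [lra | by field; lra].
exists Y; split => // x; apply/eqP; rewrite -subr_eq0; apply/eqP.
apply: (lim0 _ (2 * (rnorm x / (1 - q)) + 2 * (rnorm x / (1 - q)))) => n.
have -> : Y x + Y x - (B x + Y (Y x)) = 2%:C *: (Y x - Yn n.+1 x) -
    (Y (Y x - Yn n x) + (Y (Yn n x) - Yn n (Yn n x))).
  rewrite (linB _ Y_lin) addrA subrK scalerBr.
  rewrite -[Yn n.+1 x]/(2^-1%:C *: _) scalerA -rmorphM mulfV ?pnatr_eq0// scale1r.
  rewrite (_ : 2%:C *: Y x = Y x + Y x); last first.
    by rewrite rmorph_nat scaler_nat mulr2n.
  by rewrite opprB !opprD !addrA subrK.
rewrite mulrDl; apply: le_trans (rnormD _ _) _; rewrite rnormN rnormZr ger0_norm ?ler0n//.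
have e0 : 0 <= q ^+ n by rewrite exprn_ge0.
have h1 := hY x n.+1; have h2 := hY x n; have h3 := hY (Yn n x) n.
have h4 := rnormD (Y (Y x - Yn n x)) (Y (Yn n x) - Yn n (Yn n x)).
have h5 := Yq (Y x - Yn n x).
have h6 : q * rnorm (Y x - Yn n x) <= rnorm (Y x - Yn n x).
  by rewrite -[leRHS]mul1r ler_wpM2r ?rnorm_ge0 ?ltW.
have h7 : rnorm (Yn n x) / (1 - q) * q ^+ n <= rnorm x / (1 - q) * q ^+ n.
  rewrite ler_wpM2r// ler_wpM2r ?invr_ge0 ?(ltW p0)//.
  by apply: le_trans (Ynq n x) _; rewrite -[leRHS]mul1r ler_wpM2r ?rnorm_ge0 ?ltW.
have h8 : rnorm x / (1 - q) * q ^+ n.+1 <= rnorm x / (1 - q) * q ^+ n.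
  rewrite exprS mulrCA -[leRHS]mul1r ler_wpM2r ?(ltW q1)//.
  by rewrite mulr_ge0// mulr_ge0 ?rnorm_ge0 ?invr_ge0 ?(ltW p0).
lra.
Qed.

(** With [t = m^-2], nonnegativity of [P] at [x - t P x] gives
[t |P x|^2 <= (P x, x)], hence [|x - t P x|^2 <= |x|^2 - t^2 |P x|^2], and the
lower bound on [P] turns the subtracted term into a fraction of [|x|^2]. *)
Lemma scaled_contraction (P : H -> H) m N : linear P ->
  (forall x y, rdot (P x) y = rdot x (P y)) -> (forall x, 0 <= rdot (P x) x) ->
  1 <= m -> 1 <= N -> (forall x, rnorm (P x) <= m ^+ 2 * rnorm x) ->
  (forall x, rnorm x <= N * rnorm (P x)) ->
  exists q, [/\ 0 <= q, q < 1 &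
    forall x, rnorm (x - (m ^- 2)%:C *: P x) <= q * rnorm x].
Proof.
move=> P_lin P_sym P_ge0 m1 N1 Pm PN.
have t0 : 0 < m ^- 2 by rewrite invr_gt0 exprn_gt0//; lra.
have tm : m ^- 2 * m ^+ 2 = 1 by rewrite mulVf// sqrf_eq0; lra.
set t := m ^- 2 in t0 tm *.
have t1 : t <= 1 by rewrite invf_le1 ?exprn_gt0 ?exprn_ege1//; lra.
have PP x : t * rnorm (P x) ^+ 2 <= rdot (P x) x.
  have := P_ge0 (x - t%:C *: P x); rewrite (linB _ P_lin) (linZ _ P_lin).
  rewrite !redotDl !redotDr !redotNl !redotNr !redotZl !redotZr.
  rewrite [rdot (P (P x)) x]P_sym redotxx//.
  have h : rdot (P (P x)) (P x) <= m ^+ 2 * rnorm (P x) ^+ 2.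
    apply: le_trans (redot_le _ hdot _ _) _; rewrite [rnorm (P x) ^+ 2]expr2 mulrA.
    by rewrite ler_wpM2r ?rnorm_ge0.
  have : t * (t * rdot (P (P x)) (P x)) <= t * (t * (m ^+ 2 * rnorm (P x) ^+ 2)).
    by rewrite !ler_wpM2l// ltW.
  rewrite [in leRHS](mulrA t (m ^+ 2)) tm; lra.
pose d := t ^+ 2 / N ^+ 2.
have d0 : 0 < d by rewrite divr_gt0 ?exprn_gt0//; lra.
have d1 : d <= 1.
  by rewrite ler_pdivrMr ?exprn_gt0 ?mul1r ?ler_pXn2r ?nnegrE //; lra.
(* [1 - d / 2] dominates the square root of [1 - d]. *)
exists (1 - d / 2); split; [lra|lra|move=> x].
rewrite -(ler_pXn2r (isT : (0 < 2)%N)) ?nnegrE ?rnorm_ge0 ?mulr_ge0 ?rnorm_ge0//;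
  last by lra.
rewrite (rnormD_sqr _ hdot) rnormN rnormZr ger0_norm ?(ltW t0)// redotNr redotZr.
rewrite [rdot x _]redotC exprMn.
have h1 := PP x; have h2 : t * (t * rnorm (P x) ^+ 2) <= t * rdot (P x) x.
  by rewrite ler_wpM2l// ltW.
have h3 : d * rnorm x ^+ 2 <= t ^+ 2 * rnorm (P x) ^+ 2.
  rewrite /d -mulrA ler_wpM2l ?sqr_ge0// mulrC ler_pdivrMr ?exprn_gt0//; last by lra.
  by rewrite -exprMn mulrC ler_pXn2r ?nnegrE ?mulr_ge0 ?rnorm_ge0//; lra.
have h4 : 0 <= d ^+ 2 * rnorm x ^+ 2 by rewrite mulr_ge0 ?sqr_ge0.
have -> : ((1 - d / 2) * rnorm x) ^+ 2 =
    rnorm x ^+ 2 - d * rnorm x ^+ 2 + d ^+ 2 * rnorm x ^+ 2 / 4.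
  by field.
by move: h2; rewrite mulrA -expr2 => h2; lra.
Qed.

(** The bound on [P] is taken as a square [m^2] so that [m (1 - Y)] is the root
without extracting a root of the scalar. *)
Lemma positive_sqrt (P : H -> H) m N : linear P ->
  (forall x y, rdot (P x) y = rdot x (P y)) -> (forall x, 0 <= rdot (P x) x) ->
  1 <= m -> 1 <= N -> (forall x, rnorm (P x) <= m ^+ 2 * rnorm x) ->
  (forall x, rnorm x <= N * rnorm (P x)) ->
  exists S : H -> H, [/\ linear S, forall x y, rdot (S x) y = rdot x (S y),
    forall x, rnorm (S x) <= m * 2 * rnorm x & forall x, S (S x) = P x].
Proof.
move=> P_lin P_sym P_ge0 m1 N1 Pm PN.
have [q [q0 q1 Bq]] := scaled_contraction _ _ _ P_lin P_sym P_ge0 m1 N1 Pm PN.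
have [||Y [Y_lin Y_sym Yq Y2]] := sqrt_fixpoint _ _ q0 q1 _ _ Bq.
- move=> a x y; rewrite P_lin scalerDr opprD addrACA scalerBr !scalerA.
  by rewrite [_ * a]mulrC.
- by move=> x y; rewrite redotDl redotDr redotNl redotNr redotZl redotZr P_sym.
exists (fun x => m%:C *: (x - Y x)); split.
- move=> a x y; rewrite Y_lin opprD addrACA -scalerBr scalerDr !scalerA.
  by rewrite [_ * a]mulrC.
- by move=> x y; rewrite redotZl redotZr redotDl redotDr redotNl redotNr Y_sym.
- move=> x; rewrite rnormZr ger0_norm; last by lra.
  rewrite -mulrA ler_wpM2l//; first by lra.
  apply: le_trans (rnormD _ _) _; rewrite rnormN; have := Yq x.
  have : q * rnorm x <= 1 * rnorm x by rewrite ler_wpM2r ?rnorm_ge0// ltW.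
  lra.
- move=> x; rewrite (linZ _ Y_lin) (linB _ Y_lin) -scalerBr scalerA -rmorphM -expr2.
  have -> : x - Y x - (Y x - Y (Y x)) = (m ^- 2)%:C *: P x.
    have -> : Y (Y x) = Y x + Y x - (x - (m ^- 2)%:C *: P x).
      by rewrite Y2 addrAC subrr add0r.
    by rewrite -[Y x + Y x - _]addrA opprB [Y x + _]addrC addrK subrKA subKr.
  rewrite scalerA -rmorphM mulfV ?scale1r// sqrf_eq0; lra.
Qed.

End SquareRoot.

(** * Adjoints, inverses and similarity *)

Section Operators.
Context {R : realType} {H : completeNormedModType R[i]}.
Context (dot : {dot H for @Num.conj R[i]}) (hdot : is_inner_product dot).
Implicit Types (x y z u v w : H) (A B L K : operator H).
Local Notation rdot := (redot dot).

Lemma dense_separates (D : set H) v w : dense D ->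
  (forall u, D u -> dot u v = dot u w) -> v = w.
Proof.
move=> /dense_rnormP dD h; apply/eqP; rewrite -subr_eq0; apply/eqP/rnorm_le0.
rewrite leNgt; apply/negP; set d := rnorm (v - w) => d0.
have [|u Du hu] := dD (v - w) (d / 2); first by lra.
have hd : rdot (v - w - u) (v - w) = d ^+ 2.
  rewrite redotDl redotxx// redotNl [rdot u _]redotDr redotNr.
  by rewrite /redot (h _ Du) subrr subr0.
have := redot_le _ hdot (v - w - u) (v - w); rewrite hd -/d.
have : rnorm (v - w - u) * d < d / 2 * d by rewrite ltr_pM2r.
nra.
Qed.

Lemma adjointP A u v : opdom (adjoint dot A) v -> opdom A u ->
  dot (A u) v = dot u (adjoint dot A v).
Proof. by move=> Av Au; exact: (xgetPex 0 Av u Au). Qed.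

Lemma adjointE A v w : dense (opdom A) ->
  (forall u, opdom A u -> dot (A u) v = dot u w) -> adjoint dot A v = w.
Proof.
move=> dA h; apply: (dense_separates _ _ _ dA) => u Au.
by rewrite -adjointP// ?h//; exists w.
Qed.

Lemma self_adjoint_sym L u v : self_adjoint dot L -> opdom L u -> opdom L v ->
  dot (L u) v = dot u (L v).
Proof.
move=> [_ _ [domE valE]] Lu Lv.
by rewrite (valE _ Lv) adjointP// -domE.
Qed.

Lemma linear_of_op (f : H -> H) (D : set H) :
  linear_op (Operator D f) -> D = setT -> linear f.
Proof. by move=> [_ _ fl] DT a x y; apply: fl; rewrite /= DT. Qed.

Lemma op_of_linear (f : H -> H) : linear f -> linear_op (Operator setT f).
Proof. by move=> fl; split=> // a u v _ _; exact: fl. Qed.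

Lemma bounded_op_rnorm A : bounded_op A ->
  [/\ linear A, opdom A = setT &
    exists2 c, 0 <= c & forall x, rnorm (A x) <= c * rnorm x].
Proof.
move=> [Al AT [c Ac]]; split=> //.
  by case: A Al AT {Ac} => D f /=; exact: linear_of_op.
exists `|c| => // x; apply: (@le_trans _ _ (c * rnorm x)).
  by rewrite -lecR rmorphM /= -!norm_rnorm.
by rewrite ler_wpM2r ?rnorm_ge0 ?ler_norm.
Qed.

Lemma bounded_op_of_linear (f : H -> H) c : linear f ->
  (forall x, rnorm (f x) <= c * rnorm x) -> bounded_op (Operator setT f).
Proof.
move=> fl fc; split; [exact: op_of_linear|by []|].
by exists c => x; rewrite !norm_rnorm -rmorphM lecR.
Qed.

Lemma bounded_adjoint K : bounded_op K -> opdom (adjoint dot K) = setT.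
Proof.
move=> /bounded_op_rnorm[Kl KT [c c0 Kc]]; apply/seteqP; split=> // v _.
have [|||w hw] := @riesz _ _ _ hdot (fun u => rdot (K u) v) (c * rnorm v).
- by move=> x y; rewrite (linD _ Kl) redotDl.
- by move=> r x; rewrite (linZ _ Kl) redotZl.
- move=> x; apply: le_trans (redot_le _ hdot _ _) _.
  by rewrite mulrAC ler_wpM2r ?rnorm_ge0.
exists w => u _; apply: dot_of_redot; first exact: hw.
by rewrite -(linZ _ Kl) hw.
Qed.

Lemma correct_inj A : linear_op A -> correctly_solvable A ->
  forall u v, opdom A u -> opdom A v -> A u = A v -> u = v.
Proof.
move=> [_ AD Al] [C _ AC] u v Au Av uv.
have D : opdom A ((-1) *: v + u) by exact: AD.
have := AC _ D; rewrite Al// uv !scaleN1r addNr normr0 mulr0 normr_le0.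
by rewrite addrC subr_eq0 => /eqP.
Qed.

Lemma inv_opE A u :
  (forall u v, opdom A u -> opdom A v -> A u = A v -> u = v) ->
  opdom A u -> inv_op A (A u) = u.
Proof.
move=> inj Au.
have ex : exists v, opdom A v /\ A v = A u by exists u.
have [Au' e] := xgetPex 0 ex.
exact: inj.
Qed.

(** The operator [M] is [L S^-2], and [A = S^-1 L S^-1] is self-adjoint because
[S^-1], here called [G], is symmetric: a relation [(A u, v) = (u, w)] for all
[u = S z] says that [(L z, G v) = (z, S w)]. *)
Lemma similar_self_adjoint L M (S G : H -> H) c d : self_adjoint dot L ->
  linear S -> (forall x y, rdot (S x) y = rdot x (S y)) ->
  (forall x, rnorm (S x) <= c * rnorm x) ->
  (forall x, rnorm (G x) <= d * rnorm x) -> cancel S G -> cancel G S ->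
  op_eq M (Operator [set u | opdom L (G (G u))] (fun u => L (G (G u)))) ->
  exists A, self_adjoint dot A /\ similar_op M A.
Proof.
move=> L_sa S_lin S_sym Sc Gd SK GK [Mdom Mval].
have [[L0 LD Ll] /dense_rnormP dL [Ldom Lval]] := L_sa.
have G_lin : linear G by move=> a x y; rewrite -{1}(GK x) -{1}(GK y) -S_lin SK.
have dotS x y : dot (S x) y = dot x (S y).
  by apply: dot_of_redot; rewrite ?S_sym// -(linZ _ S_lin) S_sym.
have dotG x y : dot (G x) y = dot x (G y).
  by rewrite -{1}(GK y) -dotS GK.
pose A := Operator [set u | opdom L (G u)] (fun u => G (L (G u))).
have A_lin : linear_op A.
  split=> /=; first by rewrite (lin0 _ G_lin).
    by move=> a u v Lu Lv; rewrite G_lin; exact: LD.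
  by move=> a u v Lu Lv; rewrite G_lin Ll// G_lin.
have A_dense : dense (opdom A).
  apply/dense_rnormP => x e e0; have c0 : 0 < `|c| + 1 by rewrite ltr_wpDl.
  have [|u Lu xu] := dL (G x) (e / (`|c| + 1)); first by rewrite divr_gt0.
  exists (S u); first by rewrite /= SK.
  rewrite -{1}(GK x) -(linB _ S_lin).
  apply: le_lt_trans (Sc _) _.
  apply: (@le_lt_trans _ _ ((`|c| + 1) * rnorm (G x - u))).
    by rewrite ler_wpM2r ?rnorm_ge0// (le_trans (ler_norm c))// lerDl.
  by rewrite mulrC -ltr_pdivlMr.
have A_sym u v : opdom A u -> opdom A v -> dot (A u) v = dot u (A v).
  by move=> Au Av; rewrite /= dotG (self_adjoint_sym _ _ _ L_sa)// dotG.
have A_sa : self_adjoint dot A.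
  split=> //; split; last first.
    by move=> v Av; apply/esym/adjointE => // u Au; exact: A_sym.
  apply/seteqP; split=> v.
    by move=> Av; exists (A v) => u Au; exact: A_sym.
  move=> [w hw]; rewrite /= Ldom; exists (S w) => u Lu.
  have := hw (S u); rewrite /= SK => /(_ Lu).
  by rewrite dotG dotS.
pose So := Operator setT S.
have So_inj u v : opdom So u -> opdom So v -> So u = So v -> u = v.
  by move=> _ _; exact: (can_inj SK).
have invS x : inv_op So x = G x by rewrite -{1}(GK x) (inv_opE So).
have ranS x : oprange So x by exists (G x) => //=; rewrite GK.
exists A; split=> //; exists So; split.
- exact: bounded_op_of_linear Sc.
- split; first by move=> u v _ _ ; exact: (can_inj SK).
  have -> : inv_op So = Operator setT G.
    rewrite -[LHS]/(Operator (oprange So) (inv_op So)); congr Operator.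
      by apply/seteqP; split.
    by apply/funext.
  exact: bounded_op_of_linear Gd.
- split=> [|u Mu].
    rewrite Mdom; apply/seteqP; split=> u h.
      change ((oprange So u /\ opdom L (G (inv_op So u))) /\ True).
      by rewrite invS; split=> //; split=> //; exact: ranS.
    have [[_ /=]] : (oprange So u /\ opdom L (G (inv_op So u))) /\ True.
      by exact: h.
    by rewrite -[xget _ _]/(inv_op So u) invS.
  rewrite Mval//=; change (L (G (G u)) = S (G (L (G (inv_op So u))))).
  by rewrite invS GK.
Qed.

(** The range condition makes [L K^*] an everywhere defined formal adjoint of
[K L], so that [K L] is bounded; its closure is then a bounded everywhere
defined map [T], which extends [K L]. *)
Lemma closure_comp_bounded L K : self_adjoint dot L -> bounded_op K ->
  oprange (adjoint dot K) `<=` opdom L ->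
  exists T : H -> H, exists2 c, 0 <= c &
  [/\ linear T, forall x, rnorm (T x) <= c * rnorm x,
    forall u, opdom L u -> T u = K (L u) & closure_op (comp_op K L) = Operator setT T].
Proof.
move=> L_sa K_bd K_range.
have [Kl KT _] := bounded_op_rnorm _ K_bd.
have [[L0 LD Ll] dL _] := L_sa.
have Kdom := bounded_adjoint _ K_bd.
have domE : opdom (comp_op K L) = opdom L.
  by rewrite /= KT; apply/seteqP; split=> [u []|u].
have [|c c0 Bc] := @hellinger_toeplitz _ _ _ hdot (opdom L) (fun u => K (L u))
    (fun v => L (adjoint dot K v)).
  move=> u v Lu; rewrite /redot adjointP ?Kdom ?KT//.
  congr complex.Re; apply: self_adjoint_sym => //.
  by apply: K_range; exists v => //; rewrite Kdom.
have [|||T [T_lin Tc clT]] := @bounded_closure _ _ (comp_op K L) c _ _ c0.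
- split; rewrite domE//= => a u v Lu Lv.
  by rewrite Ll// Kl.
- by rewrite domE.
- by move=> u; rewrite domE; exact: Bc.
have TE u v : closure (opgraph (comp_op K L)) (u, v) -> v = T u.
  by case: (clT u v).
exists T, c => //; split=> //.
- move=> u Lu; apply/esym/TE/subset_closure.
  by split=> //=; rewrite KT.
- rewrite /closure_op; congr Operator.
    by apply/seteqP; split=> // x _; exists (T x); apply/clT.
  apply/funext => x.
  have := @xgetPex _ 0 [set v | closure (opgraph (comp_op K L)) (x, v)].
  by move=> /(_ (ex_intro _ (T x) ((clT x (T x)).2 erefl))) /TE.
Qed.

End Operators.

(** * Similarity to a self-adjoint operator *)

Theorem theorem1p2 (R : realType) (H : completeNormedModType R[i])
    (dot : {dot H for @Num.conj R[i]}) (hdot : is_inner_product dot)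
    (L0 Lhat L LK K : operator H)
    (L0_sym : symmetric_op dot L0) (L0_min : minimal_op L0)
    (Lhat_def : op_eq Lhat (adjoint dot L0)) (Lhat_max : maximal_op Lhat)
    (L_sa : self_adjoint dot L) (L_correct : correct_op L)
    (L_ext : restriction_of L0 L)
    (LK_lin : linear_op LK) (LK_correct : correct_op LK)
    (LK_restr : restriction_of LK Lhat)
    (K_bounded : bounded_op K) (K_range : oprange K `<=` opker Lhat)
    (LK_inv : forall f : H, inv_op LK f = inv_op L f + K f)
    (Kadj_range : oprange (adjoint dot K) `<=` opdom L)
    (IKL_ge0 : nonneg_op dot (add_op (id_op H) (closure_op (comp_op K L))))
    (IKL_inv : invertible_op (add_op (id_op H) (closure_op (comp_op K L)))) :
  exists A : operator H, self_adjoint dot A /\ similar_op LK A.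
Proof.
have [L_lin _ _] := L_sa.
have [T [c c0 [T_lin Tc TE clT]]] :=
  closure_comp_bounded _ hdot _ _ L_sa K_bounded Kadj_range.
set P := add_op (id_op H) (closure_op (comp_op K L)).
have PE x : P x = x + T x by rewrite /P clT.
have Pdom x : opdom P x by rewrite /P clT.
have P_lin : linear P.
  by move=> a x y; rewrite !PE T_lin addrACA -scalerDr.
have P_ge0 x : 0 <= dot (P x) x by apply: IKL_ge0.
have P_sym := nonneg_sym dot P P_lin P_ge0.
have P_inj x y : P x = P y -> x = y.
  by move=> e; case: IKL_inv => inj _; apply: inj; rewrite ?inE//; exact: Pdom.
have [_ gT [N N0 gN]] := bounded_op_rnorm _ IKL_inv.2.
pose g := inv_op P.
have PK : cancel P g by move=> x; apply: (inv_opE P) => // u v _ _; exact: P_inj.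
have gK : cancel g P.
  move=> y; have : opdom g y by rewrite /g /P gT.
  by move=> [x _ <-]; rewrite PK.
have [|||||S [S_lin S_sym Sc SS]] :=
  positive_sqrt dot hdot P (1 + c) (1 + N) P_lin P_sym.
- by move=> x; have := P_ge0 x; rewrite lecE => /andP[].
- by rewrite lerDl.
- by rewrite lerDl.
- move=> x; rewrite PE; apply: le_trans (rnormD _ _) _.
  have := Tc x; have := rnorm_ge0 x; nra.
- move=> x; have := gN (P x); rewrite -/P -/g PK => h.
  by apply: le_trans h _; rewrite ler_wpM2r ?rnorm_ge0// lerDr.
(* [S^-1 = S P^-1]. *)
pose G x := S (g x).
have S_inj x y : S x = S y -> x = y by move=> e; apply: P_inj; rewrite -!SS e.
have GK : cancel G S by move=> x; rewrite /G SS gK.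
have SK : cancel S G by move=> x; apply: S_inj; rewrite GK.
have GG x : G (G x) = g x.
  by apply: P_inj; rewrite gK -SS !GK.
have Gd x : rnorm (G x) <= (1 + c) * 2 * N * rnorm x.
  apply: le_trans (Sc _) _; rewrite -[leRHS]mulrA ler_wpM2l//; lra.
apply: (similar_self_adjoint dot hdot L LK S G _ _ L_sa S_lin S_sym Sc Gd SK GK).
have L_inj := correct_inj L L_lin L_correct.1.
have LK_inj := correct_inj LK LK_lin LK_correct.1.
(* [L_K^-1 = P L^-1]. *)
have LKE u w : opdom L u -> opdom LK w -> LK w = L u -> w = P u.
  move=> Lu LKw e; have := LK_inv (L u).
  by rewrite (inv_opE L)// -e (inv_opE LK)// e -TE// PE.
split=> [|w LKw] /=.
  apply/seteqP; split=> w.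
    move=> LKw; have [u Lu e] : oprange L (LK w) by rewrite L_correct.2.
    by rewrite /= GG (LKE u w)// PK.
  rewrite /= GG => Lu.
  have [v LKv e] : oprange LK (L (g w)) by rewrite LK_correct.2.
  by rewrite -(gK w) -(LKE _ v).
have [u Lu e] : oprange L (LK w) by rewrite L_correct.2.
by rewrite GG [in RHS](LKE u w)// PK.
Qed.
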